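(* Let $L>0$. For any smooth field $f:M\to\mathbb R$ and any coordinate direction $y\in\{t,x_1,x_2,x_3\}$, $$\frac{\partial}{\partial y}\bigl(\phi_L^*f\bigr)=L\,\phi_L^*\Bigl(\frac{\partial f}{\partial Y}\Bigr),$$ where $Y$ is the corresponding dilated coordinate ($T$ for $t$, $X_i$ for $x_i$). Equivalently, $$\frac{\partial}{\partial y}\bigl[f(Lt,Lx)\bigr]=L\,(\partial_Yf)(Lt,Lx).$$
   Context: $M=I\times\Omega$ with $I\subset\mathbb R$ an open interval and $\Omega\subset\mathbb R^3$ open, with coordinates $(t,x_1,x_2,x_3)$, such that for every $L>0$ the dilation $\phi_L(t,x)=(Lt,Lx)$ maps $M$ onto $M$. The pullback is $(\phi_L^*f)(t,x)=f(Lt,Lx)$. The coordinates on the target copy of $M$ are written $(T,X_1,X_2,X_3)=\phi_L(t,x_1,x_2,x_3)$, and $\partial_Tf$, $\partial_{X_i}f$ denote the partial derivatives of $f$ with respect to its time argument and its $i$-th spatial argument. *)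

(* Defs.v *)
From HB Require Import structures.
From mathcomp Require Import all_boot all_order all_algebra.
From mathcomp Require Import all_classical all_reals all_analysis.

Set Implicit Arguments.
Unset Strict Implicit.
Unset Printing Implicit Defensive.

Import Order.TTheory GRing.Theory Num.Theory.
Import numFieldNormedType.Exports.

Local Open Scope classical_set_scope.
Local Open Scope ring_scope.

Inductive coordinate := coord_t | coord_x of 'I_3.

Definition coord_vec (R : realType) (y : coordinate) : R * 'rV[R]_3 :=
  match y with
  | coord_t => (1, 0)
  | coord_x i => (0, delta_mx 0 i)
  end.

Definition partial (R : realType) (y : coordinate) (f : R * 'rV[R]_3 -> R) :
    R * 'rV[R]_3 -> R :=
  'D_(coord_vec R y) f.

(* A field on an open set [M] is represented by a total function of which only
   the values on [M] matter: as [M] is open, derivability, partial derivatives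
   and continuity at a point of [M] do not depend on the values outside [M].
   [smooth_on M f] says that every iterated partial derivative of [f] exists
   and is continuous on [M]. *)
Definition smooth_on (R : realType) (M : set (R * 'rV[R]_3))
    (f : R * 'rV[R]_3 -> R) : Prop :=
  forall (s : seq coordinate) (p : R * 'rV[R]_3), M p ->
    {for p, continuous (foldr (@partial R) f s)} /\
    forall y : coordinate, derivable (foldr (@partial R) f s) p (coord_vec R y).

Definition dilation (R : realType) (L : R) (p : R * 'rV[R]_3) :
    R * 'rV[R]_3 :=
  (L * p.1, L *: p.2).

Definition pullback (R : realType) (L : R) (f : R * 'rV[R]_3 -> R) :
    R * 'rV[R]_3 -> R :=
  f \o dilation L.

(* Main.v *)
Require Import Defs.
From HB Require Import structures.
From mathcomp Require Import all_boot all_order all_algebra.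
From mathcomp Require Import all_classical all_reals all_analysis.

Set Implicit Arguments.
Unset Strict Implicit.
Unset Printing Implicit Defensive.

Import Order.TTheory GRing.Theory Num.Theory.
Import numFieldNormedType.Exports.

Local Open Scope classical_set_scope.
Local Open Scope ring_scope.

(** A dilation is scalar multiplication by [L] on the normed space
    [R * 'rV[R]_3], so along a fixed direction [v] the step [h] at [p] becomes
    the step [L * h] at [L *: p].  The difference quotient of the pullback is
    therefore [L] times the difference quotient of [f] with step [L * h]; as
    [L * h] tends to [0] through nonzero values ([cvg_dnbhs0M]), the chain rule
    for such a map ([is_derive_scale_arg]) needs only the one directional
    derivative of [f], not its differentiability.  That derivative exists at
    [L *: p] because the dilation maps [M] into itself. *)

Lemma cvg_dnbhs0M (K : numFieldType) (L : K) :
  L != 0 -> L * h @[h --> (0 : K)^'] --> (0 : K)^'.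
Proof.
move=> L0 A.
have mulL_cvg : L * h @[h --> (0 : K)] --> (0 : K).
  by have := @mulrl_continuous K L 0; rewrite /continuous_at mulr0.
move=> /mulL_cvg nearA.
suff: \forall h \near (0 : K), h != 0 -> A (L * h) by [].
have {}nearA : \forall h \near (0 : K), L * h != 0 -> A (L * h) := nearA.
by apply: filterS nearA => h Ah h0; apply: Ah; rewrite mulf_neq0.
Qed.

(** One-dimensional chain rule for the inner map [q |-> L *: q], obtained by
    reparametrizing the step; this is why derivability of [f] in the single
    direction [v] is enough, whereas composing differentials would ask for
    differentiability. *)
Lemma is_derive_scale_arg (R : numFieldType) (V W : normedModType R)
    (f : V -> W) (L : R) (a v : V) (df : W) :
  L != 0 -> is_derive (L *: a) v f df ->
  is_derive a v (fun q => f (L *: q)) (L *: df).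
Proof.
move=> L0 [fd <-].
have quotient_cvg :
    h^-1 *: (f (L *: (h *: v + a)) - f (L *: a)) @[h --> (0 : R)^'] -->
    L *: 'D_v f (L *: a).
  have quotientE : (fun h => h^-1 *: (f (L *: (h *: v + a)) - f (L *: a))) =
      (fun h => L *: ((L * h)^-1 *: (f ((L * h) *: v + L *: a) - f (L *: a)))).
    apply/funext => h.
    by rewrite (scalerDr L) !scalerA invfM mulVKf.
  rewrite quotientE; apply: cvgZl_tmp.
  have quotient_compL := cvg_comp _ _ (cvg_dnbhs0M L0) fd.
  exact: quotient_compL.
apply: DeriveDef; first exact: cvgP quotient_cvg.
exact: cvg_lim quotient_cvg.
Qed.

Theorem lemma3p4 (R : realType) (I : set R) (Omega : set 'rV[R]_3)
    (I_open : open I) (I_interval : is_interval I) (Omega_open : open Omega)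
    (M_dilation : forall K : R, 0 < K ->
       dilation K @` (I `*` Omega) = I `*` Omega)
    (L : R) (L_gt0 : 0 < L)
    (f : R * 'rV[R]_3 -> R) (f_smooth : smooth_on (I `*` Omega) f)
    (y : coordinate) :
  (forall p : R * 'rV[R]_3, (I `*` Omega) p ->
     derivable (pullback L f) p (coord_vec R y) /\
     partial y (pullback L f) p = L * pullback L (partial y f) p) /\
  (forall (t : R) (x : 'rV[R]_3), I t -> Omega x ->
     partial y (fun q : R * 'rV[R]_3 => f (L * q.1, L *: q.2)) (t, x) =
     L * partial y f (L * t, L *: x)).
Proof.
have pullback_derive p : (I `*` Omega) p ->
    is_derive p (coord_vec R y) (pullback L f)
      (L * pullback L (partial y f) p).
  move=> Mp.
  have MLp : (I `*` Omega) (dilation L p).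
    by rewrite -(M_dilation L L_gt0); exists p.
  (* The empty list of iterated partials gives the first derivative of [f]. *)
  have [_ /(_ y) /derivableP f_derive] := f_smooth [::] _ MLp.
  exact: is_derive_scale_arg (lt0r_neq0 L_gt0) f_derive.
split=> [p /pullback_derive[] //|t x It Ox].
by have [_ dE] := pullback_derive (t, x) (conj It Ox).
Qed.
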